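(* If $D$ is a $4$-transitive critical kernel imperfect digraph, then $D\cong\overrightarrow{A}_3$ or $D\cong\overrightarrow{A}_4$.
   Context: All digraphs are finite, with no loops and no multiple arcs (a pair of opposite arcs is allowed). A kernel of $D$ is a set $K\subseteq V(D)$ that is independent (no arcs between its vertices) and absorbent (for every $u\in V(D)\setminus K$ there is $v\in K$ with $(u,v)\in A(D)$). $D$ is critical kernel imperfect if $D$ has no kernel but every proper induced subdigraph of $D$ has a kernel. A $k$-path is a directed path (distinct vertices) of length $k$. $D$ is $4$-transitive if for all vertices $u,v$, the existence of a $4$-path from $u$ to $v$ implies $(u,v)\in A(D)$. For $n\ge3$, $\overrightarrow{A}_n$ is the digraph with vertex set $\mathbb{Z}_n$ and arcs $(i,j)$ for $j-i\in\{1,\dots,n-2\}$ (so $\overrightarrow{A}_3$ is the directed $3$-cycle). *)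

(* Defs.v *)
From mathcomp Require Import all_boot all_algebra.

Set Implicit Arguments.
Unset Strict Implicit.
Unset Printing Implicit Defensive.

Section Digraph.

(* A finite digraph is a finType of vertices with its arc relation; a relation
   has no multiple arcs, and loops are excluded by [irreflexive] in the
   statements. *)
Variables (T : finType) (arc : rel T).

Definition independent (K : {set T}) : bool :=
  [forall u in K, forall v in K, ~~ arc u v].

Definition absorbent (K : {set T}) : bool :=
  [forall (u | u \notin K), exists v in K, arc u v].

Definition kernel (K : {set T}) : bool := independent K && absorbent K.

Definition has_kernel : bool := [exists K : {set T}, kernel K].

Definition induced (S : {set T}) : rel {x : T | x \in S} :=
  fun x y => arc (val x) (val y).

(* [p] lists the vertices after [u], so [size p] is the length of the path. *)
Definition kpath (k : nat) (u v : T) (p : seq T) : bool :=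
  [&& path arc u p, uniq (u :: p), size p == k & last u p == v].

Definition ktransitive (k : nat) : Prop :=
  forall u v : T, (exists p : seq T, kpath k u v p) -> arc u v.

End Digraph.

Definition critical_kernel_imperfect (T : finType) (arc : rel T) : Prop :=
  ~~ has_kernel arc /\
  forall S : {set T}, S \proper [set: T] -> has_kernel (@induced T arc S).

Definition digraph_iso (T U : finType) (arcT : rel T) (arcU : rel U) : Prop :=
  exists2 f : T -> U, bijective f & forall x y, arcU (f x) (f y) = arcT x y.

(* Only meaningful for [2 < n]; then ['Z_n] is Z/nZ, and the coercion of
   [(j - i)%R] to nat is the residue of j - i in {0, ..., n - 1}. *)
Definition vecA (n : nat) : rel 'Z_n :=
  fun i j => 1 <= (j - i)%R <= n - 2.
Arguments vecA : clear implicits.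

(* Main.v *)
(** Let A be the set of arcs of D whose reverse is not an arc.  If no arc of A
    left some nonempty proper S, then a kernel of D[S] together with a kernel of
    the subdigraph of the vertices outside S that it does not absorb would be a
    kernel of D; hence A is strong.  A is again 4-transitive, because an arc of A
    lies on no 5-cycle of D.  So A-distances are at most 3, and A contains a
    3-cycle or a 4-cycle.  An A-triangle has no kernel, so it is all of D.
    If A has no triangle, a vertex outside an A-4-cycle joined to one vertex of
    it by an arc of A is joined in the same direction to all four; following a
    short path back to the cycle gives a contradiction, so the 4-cycle spans D.
    Both its diagonals are then symmetric arcs: the ends of a missing diagonal
    would form a kernel. *)
Require Import Defs.
From mathcomp Require Import all_boot all_algebra.

Set Implicit Arguments.
Unset Strict Implicit.
Unset Printing Implicit Defensive.

(** * Kernels, and kernels of induced subdigraphs *)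

Section InducedKernel.

Variables (T : finType) (arc : rel T).

Lemma kernelP (K : {set T}) :
  reflect ({in K &, forall u v, ~~ arc u v} /\
           forall u, u \notin K -> exists2 v, v \in K & arc u v)
          (kernel arc K).
Proof.
apply: (iffP andP) => -[indK absK]; split.
- by move=> u v uK vK; apply: (forall_inP (forall_inP indK u uK)).
- by move=> u uK; apply/exists_inP; apply: (forall_inP absK).
- apply/forall_inP => u uK; apply/forall_inP => v vK; exact: indK.
- by apply/forall_inP => u uK; apply/exists_inP; apply: absK.
Qed.

(** Moves a kernel from the subtype to a subset of [T], so that it can be united with further
    vertices. *)
Lemma induced_kernel (S : {set T}) : has_kernel (@induced T arc S) ->
  exists K : {set T},
    [/\ K \subset S, {in K &, forall u v, ~~ arc u v} &
        forall u, u \in S -> u \notin K -> exists2 v, v \in K & arc u v].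
Proof.
case/existsP=> K /andP[indK absK]; exists (val @: K); split.
- by apply/subsetP => _ /imsetP[u _ ->]; apply: valP.
- move=> _ _ /imsetP[u uK ->] /imsetP[v vK ->].
  exact: (forall_inP (forall_inP indK u uK)).
- move=> u uS uK; have uK' : exist _ u uS \notin K.
    by apply: contra uK => uK; apply/imsetP; exists (exist _ u uS).
  have /exists_inP[v vK uv] := forall_inP absK _ uK'.
  by exists (val v); first exact: imset_f.
Qed.

End InducedKernel.

(** Indexing into [s] is injective, hence bijective by counting; its inverse is the isomorphism. *)
Lemma digraph_iso_nth (T : finType) (arc : rel T) n (x0 : T) (s : seq T) :
    (1 < n)%N -> uniq s -> size s = n -> (forall x, x \in s) ->
    (forall i j : 'Z_n, arc (nth x0 s i) (nth x0 s j) = vecA n i j) ->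
  digraph_iso arc (vecA n).
Proof.
move=> n_gt1 s_uniq s_size s_full arcE.
have ltn_s (i : 'Z_n) : i < size s by rewrite s_size -[leqRHS]Zp_cast.
have nth_inj : injective (fun i : 'Z_n => nth x0 s i).
  by move=> i j /eqP; rewrite nth_uniq // => /eqP/val_inj.
have [|f nthK fK] := inj_card_bij nth_inj.
  rewrite card_ord Zp_cast // -s_size -(card_uniqP s_uniq).
  by apply: subset_leq_card; apply/subsetP => x _; apply: s_full.
by exists f; [exists (fun i : 'Z_n => nth x0 s i) | move=> x y; rewrite -arcE !fK].
Qed.

(** * One-way arcs in a critical kernel imperfect digraph *)

Section CriticalKernelImperfect.

Variables (T : finType) (arc : rel T).
Hypotheses (arc_irr : irreflexive arc) (cki : critical_kernel_imperfect arc).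

Definition asym : rel T := fun u v => arc u v && ~~ arc v u.

Lemma asym_irr : irreflexive asym.
Proof. by move=> u; rewrite /asym arc_irr. Qed.

Lemma asym_neq u v : asym u v -> u != v.
Proof. by apply: contraTneq => ->; rewrite asym_irr. Qed.

Lemma asymC u v : asym u v -> asym v u = false.
Proof. by case/andP=> uv /negbTE vu; rewrite /asym vu. Qed.

Lemma asym_cut (S : {set T}) : S != set0 -> S != setT ->
  exists u v, [/\ u \in S, v \notin S & asym u v].
Proof.
move=> /set0Pn[s0 s0S] SnT.
have [/exists_inP[u uS /exists_inP[v vS uv]]|noarc] :=
    boolP [exists u in S, exists v in ~: S, asym u v].
  by exists u, v; rewrite in_setC in vS.
rewrite -properT in SnT; have [/negP nokernel crit] := cki; case: nokernel.
have /induced_kernel[K [KS indK absK]] := crit S SnT.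
(* [B] holds the vertices outside [S] that [K] does not absorb; it misses [s0], so it induces a
   digraph with a kernel [L]. *)
pose B := [set v in ~: S | [forall n in K, ~~ arc v n]].
have BP v : v \in B -> v \notin S /\ {in K, forall n, ~~ arc v n}.
  by rewrite !inE => /andP[vS /forall_inP].
have /crit/induced_kernel[L [LB indL absL]] : B \proper setT.
  by rewrite properT; apply/eqP => /setP/(_ s0); rewrite !inE s0S.
apply/existsP; exists (K :|: L); apply/kernelP; split=> [u v|u].
  rewrite !inE => /orP[] uX /orP[] vX; try by [apply: indK | apply: indL].
    (* An arc from [K] to [L] has no reverse, since [B] sends no arc to [K]; it would be a one-way
       arc leaving [S]. *)
    have [vS /(_ u uX) vu] := BP v (subsetP LB v vX).
    apply: contra noarc => uv; apply/exists_inP; exists u.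
      exact: (subsetP KS).
    by apply/exists_inP; exists v; rewrite ?inE // /asym uv.
  by have [_ /(_ v vX)] := BP u (subsetP LB u uX).
rewrite inE negb_or => /andP[uK uL].
have [uS|uS] := boolP (u \in S).
  by have [v vK uv] := absK u uS uK; exists v; rewrite // inE vK.
have [uB|] := boolP (u \in B).
  by have [v vL uv] := absL u uB uL; exists v; rewrite // inE vL orbT.
rewrite !inE uS /= negb_forall_in => /exists_inP[v vK].
by rewrite negbK => uv; exists v; rewrite // inE vK.
Qed.

Lemma asym_connect u v : connect asym u v.
Proof.
pose S := [set w | connect asym u w].
have [/setP/(_ v)|SnT] := eqVneq S setT; first by rewrite !inE.
have [|w [z [wS zS wz]]] := asym_cut _ SnT.
  by apply/set0Pn; exists u; rewrite inE.
by case/negP: zS; rewrite !inE in wS *; apply: connect_trans wS (connect1 wz).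
Qed.

(** The empty digraph and the one-vertex digraph have kernels; with more vertices, a one-way arc
    leaves a singleton. *)
Lemma asym_exists : exists u v, asym u v.
Proof.
have [u _|T0] := pickP (@predT T); last first.
  case: cki => /negP[]; apply/existsP; exists set0; apply/kernelP.
  by split=> [u v|u _]; [rewrite inE | have := T0 u].
have [u1|uT] := eqVneq [set u] setT; last first.
  have [|v [w [_ _ vw]]] := asym_cut _ uT; last by exists v, w.
  by apply/set0Pn; exists u; rewrite set11.
case: cki => /negP[]; apply/existsP; exists [set u]; apply/kernelP.
split=> [v w|v]; last by rewrite u1 inE.
by move=> /set1P -> /set1P ->; rewrite arc_irr.
Qed.

Lemma triangle_full a b c :
  asym a b -> asym b c -> asym c a -> [set a; b; c] = setT.
Proof.
move=> ab bc ca; apply/eqP/negP => /negP; rewrite -properT.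
case/(proj2 cki)/induced_kernel=> K [KS indK absK].
(* If [x] is in [K], its neighbours [y] and [z] are not, so only [x] can absorb [y]; but the arc
   from [x] to [y] is one-way. *)
have notinK x y z : asym x y -> asym y z -> asym z x ->
    y \in [set a; b; c] -> K \subset [set x; y; z] -> x \notin K.
  move=> xy yz zx yS Kxyz; apply/negP => xK.
  have nK w : arc x w || arc w x -> w \notin K.
    by move=> xw; apply/negP => wK; case/orP: xw; apply/negP; apply: indK.
  have yK : y \notin K by apply: nK; case/andP: xy => ->.
  have zK : z \notin K by apply: nK; case/andP: zx => ->; rewrite orbT.
  have [w wK yw] := absK y yS yK.
  have := subsetP Kxyz w wK; rewrite !inE -orbA => /or3P[] /eqP wE.
  - by case/andP: xy; rewrite -wE yw.
  - by rewrite wE (negbTE yK) in wK.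
  - by rewrite wE (negbTE zK) in wK.
have perm3 x y z : [set x; y; z] = [set y; z; x] by rewrite -setUA setUC.
have aK : a \notin K by apply: (notinK a b c); rewrite // !inE eqxx ?orbT.
have bK : b \notin K.
  by apply: (notinK b c a); rewrite // ?inE ?eqxx ?orbT // -perm3.
have cK : c \notin K.
  by apply: (notinK c a b); rewrite // ?inE ?eqxx ?orbT // perm3.
have [|w wK _] := absK a _ aK; first by rewrite !inE eqxx.
have := subsetP KS w wK; rewrite !inE -orbA.
by case/or3P=> /eqP wE; move: wK; rewrite wE; apply/negP.
Qed.

Lemma triangle_iso a b c :
  asym a b -> asym b c -> asym c a -> digraph_iso arc (vecA 3).
Proof.
move=> ab bc ca; have full := triangle_full ab bc ca.
apply: (@digraph_iso_nth _ _ 3 a [:: a; b; c]) => //.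
- by rewrite /= !inE negb_or (asym_neq ab) (asym_neq bc) eq_sym (asym_neq ca).
- by move=> x; have := in_setT x; rewrite -full !inE orbA.
- move: ab bc ca => /andP[ab /negbTE ba] /andP[bc /negbTE cb] /andP[ca /negbTE ac].
  by case=> [[|[|[|i]]] //= ?] [[|[|[|j]]] //= ?];
    rewrite ?arc_irr ?ab ?ba ?bc ?cb ?ca ?ac.
Qed.

(** * 4-transitivity of the one-way arcs *)

Hypothesis trans4 : ktransitive arc 4.

(** A reverse arc from [e] to [a] would close a 5-cycle, whose 4-path [b], [c], [d], [e], [a] would
    reverse the one-way arc from [a] to [b]. *)
Lemma asym_trans4 a b c d e : uniq [:: a; b; c; d; e] ->
  asym a b -> asym b c -> asym c d -> asym d e -> asym a e.
Proof.
move=> uniq5 /andP[ab ba] /andP[bc _] /andP[cd _] /andP[de _].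
have ae : arc a e.
  by apply: trans4; exists [:: b; c; d; e]; rewrite /kpath uniq5 /= ab bc cd de !eqxx.
rewrite /asym ae; apply: contra ba => ea.
apply: trans4; exists [:: c; d; e; a]; rewrite /kpath.
by rewrite -(rot_uniq 1) in uniq5; rewrite uniq5 /= bc cd de ea !eqxx.
Qed.

Lemma asym_dist_le3 u v :
  exists p, [/\ path asym u p, last u p = v & size p <= 3].
Proof.
have /connectP[p up ->] := asym_connect u v.
elim: {p}(size p) {-2}p (leqnn (size p)) up => [|n IHn] p.
  by case: p => // _ _; exists [::].
move=> p_le up; have [p3|p_gt3] := leqP (size p) 3; first by exists p.
case/shortenP: up => q uq q_uniq qp.
have q_le : size q <= size p by apply: uniq_leq_size qp; case/andP: q_uniq.
have [q3|] := leqP (size q) 3; first by exists q.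
case: q uq q_uniq q_le {qp} => [|a [|b [|c [|d q]]]] //= /and5P[ua ab bc cd dq].
(* A one-way arc from [u] to [d] replaces the first four arcs, which shortens the path by three. *)
move=> q_uniq q_le _; apply: (IHn (d :: q)) => /=.
  by rewrite -ltnS (leq_trans _ (leq_trans q_le p_le)) // !ltnS leqW // leqW.
rewrite dq andbT; apply: (asym_trans4 _ ua ab bc cd).
have := take_uniq 5 (s := [:: u, a, b, c, d & q]).
by rewrite /= take0; apply.
Qed.

(** * One-way 4-cycles when there is no one-way triangle *)

Hypothesis no_triangle : forall a b c, asym a b -> asym b c -> asym c a = false.

Definition asym_cycle4 a b c d := [/\ asym a b, asym b c, asym c d & asym d a].

Lemma asym_cycle4_rot a b c d : asym_cycle4 a b c d -> asym_cycle4 b c d a.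
Proof. by case. Qed.

Lemma asym_neq2 a b c : asym a b -> asym b c -> a != c.
Proof. by move=> ab bc; apply: contraTneq bc => <-; rewrite asymC. Qed.

Lemma asym_cycle4_uniq a b c d : asym_cycle4 a b c d -> uniq [:: a; b; c; d].
Proof.
case=> ab bc cd da; rewrite /= !inE !negb_or (asym_neq ab) (asym_neq bc).
by rewrite (asym_neq cd) (asym_neq2 ab bc) (asym_neq2 bc cd) eq_sym (asym_neq da).
Qed.

(** A return path of length at most 3 closes a one-way arc; lengths 0, 1 and 2 would give a loop, a
    reverse arc and a triangle. *)
Lemma asym_cycle4_exists : exists a b c d, asym_cycle4 a b c d.
Proof.
have [a [b ab]] := asym_exists.
have [[|c [|d [|e [|f p]]]] /= [bp pa // _]] := asym_dist_le3 b a.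
- by rewrite pa asym_irr in ab.
- by move: bp; rewrite pa asymC.
- by case/and3P: bp; rewrite pa => bc ca; rewrite (no_triangle bc ca) in ab.
- by case/and4P: bp; rewrite pa => bc cd da; exists a, b, c, d.
Qed.

Lemma asym_cycle4_out a b c d y : asym_cycle4 a b c d ->
  y \notin [:: a; b; c; d] ->
  {in [:: a; b; c; d] &, forall u v, asym u y -> asym v y}.
Proof.
(* The 4-path goes from [b'] round the cycle to [a'] and then to [y]; repeating this reaches every
   vertex of the cycle. *)
have next a' b' c' d' : asym_cycle4 a' b' c' d' ->
    y \notin [:: a'; b'; c'; d'] -> asym a' y -> asym b' y.
  move=> cyc yX ay; have [_ bc cd da] := cyc.
  apply: (asym_trans4 _ bc cd da ay).
  rewrite -[[:: _, _ & _]]/(rcons (rot 1 [:: a'; b'; c'; d']) y).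
  by rewrite rcons_uniq mem_rot yX rot_uniq asym_cycle4_uniq.
move=> cyc yX.
have cyc1 := asym_cycle4_rot cyc; have cyc2 := asym_cycle4_rot cyc1.
have ab := next _ _ _ _ cyc yX.
have bc : asym b y -> asym c y by apply: next cyc1 _; rewrite -(mem_rot 1) in yX.
have cd : asym c y -> asym d y by apply: next cyc2 _; rewrite -(mem_rot 2) in yX.
have da : asym d y -> asym a y.
  by apply: next (asym_cycle4_rot cyc2) _; rewrite -(mem_rot 3) in yX.
by move=> u v; rewrite !inE => /or4P[] /eqP -> /or4P[] /eqP -> uy; auto.
Qed.

Lemma asym_cycle4_in a b c d y : asym_cycle4 a b c d ->
  y \notin [:: a; b; c; d] -> asym y a -> asym y d.
Proof.
move=> cyc yX ya; have [ab bc cd _] := cyc.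
by apply: (asym_trans4 _ ya ab bc cd); rewrite cons_uniq yX asym_cycle4_uniq.
Qed.

Lemma asym_cycle4_full a b c d : asym_cycle4 a b c d -> forall x, x \in [:: a; b; c; d].
Proof.
move=> cyc; pose X := [set x in [:: a; b; c; d]].
suff /eqP XT : X == setT by move=> x; have := in_setT x; rewrite -XT inE.
apply/negP => /negP XnT; have [|x [y [xX yX xy]]] := asym_cut _ XnT.
  by apply/set0Pn; exists a; rewrite !inE eqxx.
rewrite !in_set in xX yX.
have out z zX := asym_cycle4_out cyc yX xX zX xy : asym z y.
have aX : a \in [:: a; b; c; d] by rewrite inE eqxx.
have ay := out a aX.
(* The return path from [y] to [a] must have length 3, say through [z] and [w]. *)
have [[|z [|w [|t [|? ?]]]] /= [yp pa // _]] := asym_dist_le3 y a.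
- by rewrite pa aX in yX.
- by move: yp; rewrite pa asymC.
- by case/and3P: yp; rewrite pa => yz za; rewrite (no_triangle ay yz) in za.
case/and4P: yp; rewrite pa => yz zw wa _.
(* On the cycle, [w] would have a one-way arc to [y], making [y], [z], [w] a triangle. *)
have wX : w \notin [:: a; b; c; d].
  by apply: contraL zw => /out wy; apply/negP => zw; rewrite (no_triangle yz zw) in wy.
have wd := asym_cycle4_in cyc wX wa.
have [_ _ _ da] := cyc.
(* The 4-path [a], [y], [z], [w], [d] yields an arc against the one-way arc from [d] to [a]. *)
suff : asym a d by rewrite (asymC da).
have dy : asym d y by apply: out; rewrite !inE eqxx !orbT.
have a_w : a != w by apply: contraNneq wX => <-.
apply: (asym_trans4 _ ay yz zw wd); rewrite /= !inE !negb_or a_w.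
rewrite (asym_neq ay) (asym_neq2 ay yz) [a == d]eq_sym (asym_neq da) (asym_neq yz).
rewrite (asym_neq2 yz zw) [y == d]eq_sym (asym_neq dy) (asym_neq zw).
by rewrite (asym_neq2 zw wd) (asym_neq wd).
Qed.

Lemma asym_cycle4_diag a b c d : asym_cycle4 a b c d -> arc a c /\ arc c a.
Proof.
move=> cyc; have full := asym_cycle4_full cyc; have [ab bc cd da] := cyc.
(* A one-way diagonal would form a triangle with two sides of the cycle. *)
have ac_sym : arc a c = arc c a.
  have := no_triangle ab bc; have := no_triangle cd da; rewrite /asym.
  by case: (arc a c); case: (arc c a).
suff: arc a c by rewrite -ac_sym.
(* Without the diagonal, [a] and [c] are independent; [c] absorbs [b] and [a] absorbs [d]. *)
apply: contraT => nac; case: cki => /negP[]; apply/existsP; exists [set a; c].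
apply/kernelP; split=> [u v|u].
  by rewrite !inE => /orP[] /eqP -> /orP[] /eqP ->; rewrite ?arc_irr // -ac_sym.
have := full u; rewrite !inE => /or4P[] /eqP ->; rewrite ?eqxx ?orbT // => _.
- by exists c; [rewrite !inE eqxx orbT | case/andP: bc].
- by exists a; [rewrite !inE eqxx | case/andP: da].
Qed.

Lemma asym_cycle4_iso a b c d : asym_cycle4 a b c d -> digraph_iso arc (vecA 4).
Proof.
move=> cyc; have [ac ca] := asym_cycle4_diag cyc.
have [bd db] := asym_cycle4_diag (asym_cycle4_rot cyc).
apply: (@digraph_iso_nth _ _ 4 a [:: a; b; c; d]) => //.
- exact: asym_cycle4_uniq.
- exact: asym_cycle4_full.
(* The one-way sides match differences 1 and 3, the symmetric diagonals difference 2. *)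
case: cyc => /andP[ab /negbTE ba] /andP[bc /negbTE cb].
move=> /andP[cd /negbTE dc] /andP[da /negbTE ad].
by case=> [[|[|[|[|i]]]] //= ?] [[|[|[|[|j]]]] //= ?];
  rewrite ?arc_irr ?ab ?ba ?bc ?cb ?cd ?dc ?da ?ad ?ac ?ca ?bd ?db.
Qed.

End CriticalKernelImperfect.

Theorem theorem25 (T : finType) (arc : rel T) (arc_irr : irreflexive arc)
    (trans4 : ktransitive arc 4) (cki : critical_kernel_imperfect arc) :
  digraph_iso arc (vecA 3) \/ digraph_iso arc (vecA 4).
Proof.
have [/existsP[a /existsP[b /existsP[c /and3P[ab bc ca]]]]|no3] :=
    boolP [exists a, exists b, exists c, [&& asym arc a b, asym arc b c & asym arc c a]].
  by left; apply: triangle_iso ab bc ca.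
have no_triangle a b c : asym arc a b -> asym arc b c -> asym arc c a = false.
  move=> ab bc; apply/negP => ca; case/existsP: no3; exists a.
  by apply/existsP; exists b; apply/existsP; exists c; rewrite ab bc.
have [a [b [c [d cyc]]]] := asym_cycle4_exists arc_irr cki trans4 no_triangle.
by right; apply: asym_cycle4_iso cyc.
Qed.
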